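(* For every sequence $\omega\in\{\mathbf{0},\mathbf{1},\mathbf{2}\}^{\mathbb{N}_+}$ there exists a minimal subshift $(X_\omega,\varphi_\omega)$ and an embedding (injective group homomorphism) of the Grigorchuk group $G_\omega$ into the topological full group $[[\varphi_\omega]]$.
   Context: Cantor minimal systems and topological full groups. A Cantor minimal system is a pair $(X,\varphi)$ where $X$ is a compact space homeomorphic to the Cantor set and $\varphi$ is a homeomorphism of $X$ all of whose orbits are dense. Its topological full group $[[\varphi]]$ is the group of all homeomorphisms $g$ of $X$ for which there is a continuous function $n:X\to\mathbb{Z}$ with $g(x)=\varphi^{n(x)}(x)$ for every $x\in X$. A subshift over a finite alphabet $\mathcal{A}$ is a closed shift-invariant subset $X\subset\mathcal{A}^{\mathbb{Z}}$ together with the restriction $\varphi$ of the shift map; a minimal subshift here is a subshift that is a Cantor minimal system (i.e. an infinite subshift all of whose orbits are dense). Grigorchuk groups. The binary rooted tree is identified with the set $\{0,1\}^*$ of finite binary strings, rooted at the empty string, where $v,w$ are joined by an edge if $w=vx$ for some $x\in\{0,1\}$. Let $\Omega=\{\mathbf{0},\mathbf{1},\mathbf{2}\}^{\mathbb{N}_+}$ with shift map $\sigma:\Omega\to\Omega$, $(\sigma\omega)(n)=\omega(n+1)$. Let $\varepsilon$ be the non-trivial permutation of $\{0,1\}$ and for $i,j\in\{\mathbf{0},\mathbf{1},\mathbf{2}\}$ let $\varepsilon_{ij}=\varepsilon$ if $i\ne j$ and $\varepsilon_{ij}=\mathrm{id}$ if $i=j$. For $\omega\in\Omega$, $G_\omega$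 is the group of automorphisms of the tree generated by $a,b_\omega,c_\omega,d_\omega$, where for all $x\in\{0,1\}$, $v\in\{0,1\}^*$: $a(xv)=\varepsilon(x)v$; $b_\omega(0xv)=0\,\varepsilon_{\mathbf{2}\omega(1)}(x)v$, $b_\omega(1v)=1\,b_{\sigma\omega}(v)$; $c_\omega(0xv)=0\,\varepsilon_{\mathbf{1}\omega(1)}(x)v$, $c_\omega(1v)=1\,c_{\sigma\omega}(v)$; $d_\omega(0xv)=0\,\varepsilon_{\mathbf{0}\omega(1)}(x)v$, $d_\omega(1v)=1\,d_{\sigma\omega}(v)$; all four generators fix the empty string, and $b_\omega,c_\omega,d_\omega$ fix the one-letter string $0$. *)

(* Defs.v *)
From HB Require Import structures.
From mathcomp Require Import all_boot all_order all_algebra.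
From mathcomp Require Import all_classical topology cantor.
From mathcomp Require Import zify.

Set Implicit Arguments.
Unset Strict Implicit.
Unset Printing Implicit Defensive.

Import Order.TTheory GRing.Theory Num.Theory.

Local Open Scope classical_set_scope.

(* Groups are the (possibly infinite) groupType of mathcomp.boot.monoid;
   subgroups are the corresponding subtypes. *)

Section Symmetric.
Variable T : Type.

Record sym : Type := Sym {
  sym_fun :> T -> T;
  sym_inv : T -> T;
  sym_funK : cancel sym_fun sym_inv;
  sym_invK : cancel sym_inv sym_fun }.

Lemma symP (g h : sym) : g =1 h -> g = h.
Proof.
case: g h => [g g' K K'] [h h' L L'] /= /funext gh; subst h.
have gh' : g' = h' by apply/funext => x; rewrite -[x in LHS]L' K.
by subst h'; congr Sym; exact: Prop_irrelevance.
Qed.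

HB.instance Definition _ := gen_eqMixin sym.
HB.instance Definition _ := gen_choiceMixin sym.

Definition sym1 : sym := @Sym id id (fun=> erefl) (fun=> erefl).
Definition symV (g : sym) : sym := Sym (sym_invK g) (sym_funK g).
Definition symM (g h : sym) : sym :=
  @Sym (g \o h) (sym_inv h \o sym_inv g)
    (can_comp (sym_funK g) (sym_funK h)) (can_comp (sym_invK h) (sym_invK g)).

Fact symMA : associative symM. Proof. by move=> f g h; apply: symP. Qed.
Fact sym1M : left_id sym1 symM. Proof. by move=> g; apply: symP. Qed.
Fact symM1 : right_id sym1 symM. Proof. by move=> g; apply: symP. Qed.
Fact symVM : left_inverse sym1 symV symM.
Proof. by move=> g; apply: symP => x; exact: sym_funK. Qed.
Fact symMV : right_inverse sym1 symV symM.
Proof. by move=> g; apply: symP => x; exact: sym_invK. Qed.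

HB.instance Definition _ := isGroup.Build sym symMA sym1M symM1 symVM symMV.

Lemma sym1E x : (1%g : sym) x = x. Proof. by []. Qed.
Lemma symME (g h : sym) x : (g * h)%g x = g (h x). Proof. by []. Qed.
Lemma symVK (g : sym) : cancel g (g^-1)%g. Proof. exact: sym_funK. Qed.
Lemma symKV (g : sym) : cancel (g^-1)%g g. Proof. exact: sym_invK. Qed.

End Symmetric.

Section Generated.
Variables (G : groupType) (S : set G).

Definition gen_pred : {pred G} := fun g =>
  `[< forall H : {pred G}, group_closed H ->
        (forall s, S s -> s \in H) -> g \in H >].

Record generated : Type := Generated {
  generated_val :> G;
  generated_valP : generated_val \in gen_pred }.

Fact gen_pred_closed : group_closed gen_pred.
Proof.
split=> [|x y /asboolP Sx /asboolP Sy]; apply/asboolP => H Hg SH.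
  exact: Hg.1.
by apply: Hg.2; [exact: Sx | exact: Sy].
Qed.

HB.instance Definition _ := [isSub for generated_val].
HB.instance Definition _ := [Choice of generated by <:].
HB.instance Definition _ :=
  SubChoice_isSubGroup.Build G [in gen_pred] generated gen_pred_closed.

End Generated.

Section Homeomorphisms.
Variable X : topologicalType.

Definition homeo_pred : {pred sym X} := fun g =>
  `[< continuous g /\ continuous (sym_inv g) >].

Record homeo : Type := Homeo {
  homeo_val :> sym X;
  homeo_valP : homeo_val \in homeo_pred }.

Fact homeo_pred_closed : group_closed homeo_pred.
Proof.
split=> [|g h /asboolP[cg cg'] /asboolP[ch ch']]; apply/asboolP; split.
- by move=> x; exact: cvg_id.
- by move=> x; exact: cvg_id.
- by move=> x; apply: continuous_comp; [exact: ch' | exact: cg].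
- by move=> x; apply: continuous_comp; [exact: cg' | exact: ch].
Qed.

HB.instance Definition _ := [isSub for homeo_val].
HB.instance Definition _ := [Choice of homeo by <:].
HB.instance Definition _ :=
  SubChoice_isSubGroup.Build (sym X) [in homeo_pred] homeo homeo_pred_closed.

(* The group library only has natural powers. *)
Definition homeo_pow (phi : homeo) (n : int) : homeo :=
  match n with
  | Posz k => (phi ^+ k)%g
  | Negz k => (phi ^- k.+1)%g
  end.

Lemma homeo_pow1D phi n x :
  homeo_pow phi (n + 1)%R x = phi (homeo_pow phi n x).
Proof.
case: n => [k|[|k]].
- by rewrite -PoszD addn1 /= expgS.
- by rewrite NegzE addNr /=; rewrite -[LHS](symKV phi).
- have -> : (Negz k.+1 + 1 = Negz k)%R by rewrite !NegzE; lia.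
  by rewrite /homeo_pow [(phi ^+ k.+2)%g]expgSr invgM -[LHS](symKV phi).
Qed.

Lemma homeo_powD phi m n x :
  homeo_pow phi (m + n)%R x = homeo_pow phi m (homeo_pow phi n x).
Proof.
have step k y : phi (homeo_pow phi (k - 1)%R y) = homeo_pow phi k y.
  by rewrite -homeo_pow1D subrK.
elim: m => [|k IH|k IH]; first by rewrite add0r.
- by rewrite -addn1 PoszD addrAC !homeo_pow1D IH.
- apply: (can_inj (symVK phi)); rewrite -!homeo_pow1D.
  have -> : (- k.+1%:Z + n + 1 = - k%:Z + n)%R by lia.
  by have -> : (- k.+1%:Z + 1 = - k%:Z)%R by lia.
Qed.

End Homeomorphisms.

Definition homeomorphic (X Y : topologicalType) : Prop :=
  exists (f : X -> Y) (g : Y -> X),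
    [/\ cancel f g, cancel g f, continuous f & continuous g].

Definition orbit (X : topologicalType) (phi : homeo X) (x : X) : set X :=
  [set homeo_pow phi n x | n in [set: int]].

Definition cantor_minimal_system (X : topologicalType) (phi : homeo X) : Prop :=
  homeomorphic X cantor_space /\ forall x, dense (orbit phi x).

Section TopologicalFullGroup.
Variables (X : topologicalType) (phi : homeo X).

Definition full_group_pred : {pred homeo X} := fun g =>
  `[< exists2 n : X -> discrete_topology int,
        continuous n & forall x, g x = homeo_pow phi (n x) x >].

Record topological_full_group : Type := TopologicalFullGroup {
  full_group_val :> homeo X;
  full_group_valP : full_group_val \in full_group_pred }.

Lemma continuous_discreteP (T : choiceType) (f : X -> discrete_topology T) :
  continuous f <-> forall x, \forall y \near x, f y = f x.
Proof.
split=> cf x; first by apply: (cf x [set f x]); exact: discrete_set1.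
by apply/discrete_cvg; exact: cf.
Qed.

Fact full_group_closed : group_closed full_group_pred.
Proof.
split=> [|g h /asboolP[m cm gm] /asboolP[n cn hn]]; apply/asboolP.
  by exists (fun=> 0%R) => // x; exact: cvg_cst.
have /asboolP[_ ch'] := homeo_valP h.
pose k (x : X) : discrete_topology int :=
  (m (sym_inv h x) - n (sym_inv h x))%R.
exists k.
  apply: (iffRL (continuous_discreteP k)) => x.
  have Em : \forall z \near x, m (sym_inv h z) = m (sym_inv h x) :=
    ch' x _ ((continuous_discreteP m).1 cm (sym_inv h x)).
  have En : \forall z \near x, n (sym_inv h z) = n (sym_inv h x) :=
    ch' x _ ((continuous_discreteP n).1 cn (sym_inv h x)).
  by apply: filterS2 Em En => z; rewrite /k => -> ->.
move=> x; set y := sym_inv h x.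
have hy : h y = x by exact: sym_invK.
have -> : homeo_pow phi (k x) x = homeo_pow phi (k x) (h y) by rewrite hy.
by rewrite hn -homeo_powD /k subrK -gm.
Qed.

HB.instance Definition _ := [isSub for full_group_val].
HB.instance Definition _ := [Choice of topological_full_group by <:].
HB.instance Definition _ :=
  SubChoice_isSubGroup.Build (homeo X) [in full_group_pred]
    topological_full_group full_group_closed.

End TopologicalFullGroup.

Definition reindex (I K : Type) (s : I -> I) (x : {ptws I -> K}) :
  {ptws I -> K} := fun i => x (s i).

Fact reindex_continuous (I : eqType) (K : topologicalType) (s : I -> I) :
  continuous (@reindex I K s).
Proof.
move=> x.
have FF : Filter (reindex s y @[y --> x]) by exact/fmap_filter/nbhs_filter.
apply/cvg_sup => i U.
have /= -> := @nbhsE (initial_topology (fun f : {ptws I -> K} => f i)).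
move=> [_ [[C oC <-] /= Cx]] CU.
have nC : nbhs (x (s i)) C by apply: open_nbhs_nbhs; split.
have : \forall y \near x, C (y (s i)) :=
  @proj_continuous I (fun=> K) (s i) x C nC.
change ((\forall y \near x, C (y (s i))) -> \forall y \near x, U (reindex s y)).
by apply: (@filterS _ (nbhs x)) => y Cy; exact: CU.
Qed.

Section Subshifts.
Variable A : finType.

Definition full_shift : topologicalType := {ptws int -> discrete_topology A}.

Definition shift : full_shift -> full_shift := reindex (fun n => n + 1)%R.
Definition unshift : full_shift -> full_shift := reindex (fun n => n - 1)%R.

Fact shiftK : cancel shift unshift.
Proof. by move=> x; apply/funext => n; rewrite /shift /unshift /reindex subrK. Qed.

Fact unshiftK : cancel unshift shift.
Proof. by move=> x; apply/funext => n; rewrite /shift /unshift /reindex addrK. Qed.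

Record subshift : Type := Subshift {
  subshift_set :> set full_shift;
  subshift_closed : closed subshift_set;
  subshift_invariant : shift @` subshift_set = subshift_set }.

Variable X : subshift.

Fact subshift_mem (x : full_shift) : subshift_set X x -> subshift_set X (shift x).
Proof. by move=> Xx; rewrite -subshift_invariant; exists x. Qed.

Fact subshift_memV (x : full_shift) : subshift_set X x -> subshift_set X (unshift x).
Proof. by rewrite -{1}subshift_invariant => -[y Xy <-]; rewrite shiftK. Qed.

Definition sshift (x : X) : X :=
  exist _ (shift (val x)) (mem_set (subshift_mem (set_valP x))).
Definition sunshift (x : X) : X :=
  exist _ (unshift (val x)) (mem_set (subshift_memV (set_valP x))).

Fact sshiftK : cancel sshift sunshift.
Proof. by move=> x; apply: val_inj; exact: shiftK. Qed.

Fact sunshiftK : cancel sunshift sshift.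
Proof. by move=> x; apply: val_inj; exact: unshiftK. Qed.

Fact sshift_homeo : Sym sshiftK sunshiftK \in @homeo_pred X.
Proof.
apply/asboolP; split; apply: continuous_comp_initial => x.
  apply: (@continuous_comp X full_shift full_shift set_val shift).
    exact: initial_continuous.
  exact: reindex_continuous.
apply: (@continuous_comp X full_shift full_shift set_val unshift).
  exact: initial_continuous.
exact: reindex_continuous.
Qed.

Definition subshift_map : homeo X := Homeo sshift_homeo.

Definition minimal_subshift : Prop := cantor_minimal_system subshift_map.

End Subshifts.

Section RootedTree.

(* Vertices are finite binary strings, with the letters 0 and 1 of {0,1}
   encoded as false and true. *)
Definition tree_adj (v w : seq bool) : Prop :=
  exists x, v = rcons w x \/ w = rcons v x.

Definition tree_aut_pred : {pred sym (seq bool)} := fun g =>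
  `[< g [::] = [::] /\
      forall v w, tree_adj (g v) (g w) <-> tree_adj v w >].

Record tree_aut : Type := TreeAut {
  tree_aut_val :> sym (seq bool);
  tree_aut_valP : tree_aut_val \in tree_aut_pred }.

Fact tree_aut_closed : group_closed tree_aut_pred.
Proof.
split=> [|g h /asboolP[g0 gadj] /asboolP[h0 hadj]]; apply/asboolP; split=> //.
  by rewrite symME -{1}h0 symVK.
by move=> v w; rewrite !symME gadj -hadj !symKV.
Qed.

HB.instance Definition _ := [isSub for tree_aut_val].
HB.instance Definition _ := [Choice of tree_aut by <:].
HB.instance Definition _ :=
  SubChoice_isSubGroup.Build (sym (seq bool)) [in tree_aut_pred] tree_aut
    tree_aut_closed.

Section Involution.
Variable f : seq bool -> seq bool.
Hypotheses (fK : involutive f) (f0 : f [::] = [::]).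
Hypothesis fS : forall v x, exists y, f (rcons v x) = rcons (f v) y.

Fact involution_tree_autP : Sym fK fK \in tree_aut_pred.
Proof.
have adj v w : tree_adj v w -> tree_adj (f v) (f w).
  move=> [x [->|->]].
    by have [y ->] := fS w x; exists y; left.
  by have [y ->] := fS v x; exists y; right.
apply/asboolP; split=> // v w; split; last exact: adj.
by move/adj => /=; rewrite !fK.
Qed.

Definition involution_tree_aut : tree_aut := TreeAut involution_tree_autP.

End Involution.

End RootedTree.

Section Grigorchuk.

(* The index set N_+ is shifted to nat: omega(n) is [w n.-1] for n >= 1. *)
Definition Omega : Type := nat -> 'I_3.

Definition Omega_shift (w : Omega) : Omega := fun n => w n.+1.

Definition eps (i j : 'I_3) (x : bool) : bool := if i == j then x else ~~ x.

Definition grig_a_fun (v : seq bool) : seq bool :=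
  if v is x :: u then ~~ x :: u else [::].

(* The recursion common to b, c, d, for which [i] is 2, 1, 0 respectively. *)
Fixpoint grig_fun (i : 'I_3) (w : Omega) (v : seq bool) : seq bool :=
  match v with
  | [::] => [::]
  | [:: false] => [:: false]
  | [:: false, x & u] => [:: false, eps i (w 0) x & u]
  | true :: u => true :: grig_fun i (Omega_shift w) u
  end.

Fact grig_a_funK : involutive grig_a_fun.
Proof. by case=> //= x u; rewrite negbK. Qed.

Fact grig_a_funS v x : exists y, grig_a_fun (rcons v x) = rcons (grig_a_fun v) y.
Proof. by case: v => [|z v]; [by exists (~~ x) | by exists x]. Qed.

Fact grig_funK i w : involutive (grig_fun i w).
Proof.
move=> v; elim: v w => [//|[] u IH] w /=; first by rewrite IH.
case: u {IH} => [|x u] /=; first by [].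
by rewrite /eps; case: (i == w 0); rewrite ?negbK.
Qed.

Fact grig_funS i w v x : exists y, grig_fun i w (rcons v x) = rcons (grig_fun i w v) y.
Proof.
elim: v w => [|[] u IH] w /=; first by exists x; case: x.
  by have [y ->] := IH (Omega_shift w); exists y.
by case: u {IH} => [|z u] /=; [by exists (eps i (w 0) x) | by exists x].
Qed.

Definition grig_a : tree_aut :=
  involution_tree_aut grig_a_funK erefl grig_a_funS.

Definition grig_bcd (i : 'I_3) (w : Omega) : tree_aut :=
  involution_tree_aut (grig_funK i w) erefl (grig_funS i w).

Definition grig_b : Omega -> tree_aut := grig_bcd (@Ordinal 3 2 isT).
Definition grig_c : Omega -> tree_aut := grig_bcd (@Ordinal 3 1 isT).
Definition grig_d : Omega -> tree_aut := grig_bcd (@Ordinal 3 0 isT).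

Definition grigorchuk_group (w : Omega) : groupType :=
  generated [set grig_a; grig_b w; grig_c w; grig_d w].

End Grigorchuk.

(* Main.v *)
From HB Require Import structures.
Require Import Defs.
From mathcomp Require Import all_boot all_order all_algebra.
From mathcomp Require Import all_classical reals Rstruct topology cantor zify.
Set Implicit Arguments.
Unset Strict Implicit.
Unset Printing Implicit Defensive.
Import Order.TTheory GRing.Theory Num.Theory.
Local Open Scope classical_set_scope.

(** Let [G_w] act on the infinite binary words that end in 1s. Its Schreier
    graph there is a half-line: with the vertices numbered 0, 1, 2, and so on by
    the Gray code, the edge between [m - 1] and [m] is crossed by [a] if [m] is
    odd, and otherwise by the two of [b], [c], [d] whose index differs from
    [w (logn 2 m).-1]; a generator that crosses no edge at a vertex fixes it
    ([gray_step]). A word in the generators acts trivially on the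
    tree if and only if it acts trivially at all vertices of the half-line that
    are further from its origin than the word is long
    ([tree_word_trivialP]), because any finite word over {0,1} has an
    extension that is far out.

    Only the labels of the edges near a vertex matter, so the generators act on
    any bi-infinite sequence of labels that looks locally like the half-line:
    read the two letters next to the origin and shift the sequence by 1, -1
    or 0. The sequences all of whose windows occur in the half-line form a
    subshift, and on it the generators are involutions in the topological full
    group. A word of length [n] moves a point by an amount that depends on the
    window of radius [n] alone. If the subshift has no periodic points, a word
    is hence trivial there if and only if it is trivial on the far vertices of
    the half-line ([full_word_trivialP]), and the same words are
    trivial in both groups, so that [G_w] embeds.

    The label of edge [m] depends on the 2-adic valuation of [m], i.e. the
    sequence is Toeplitz, and this makes the subshift minimal
    ([schreier_recurrence]). For the labels [w] alone it would be finite when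
    [w] is eventually constant. Each label therefore also records the parity of
    the valuation, which the generators ignore: consecutive valuations then
    have different labels, and this excludes periodic points
    ([schreier_aperiodic]) for every [w]. A minimal subshift without periodic
    points is compact, zero-dimensional and perfect, thus a Cantor set. *)

(** * Labels and generators *)

(** [None] labels the edges that [a] crosses. *)
Notation label := (option ('I_3 * bool)).
(** [None] stands for [a], and [Some i] for [b], [c], [d] with [i] equal to
    2, 1, 0. *)
Notation gen := (option 'I_3).

(** The label of an edge whose number has 2-adic valuation [k]. The bit keeps
    the labels from being eventually constant when [w] is. *)
Definition ruler_letter (w : Omega) (k : nat) : label :=
  if k is j.+1 then Some (w j, odd j) else None.

Lemma ruler_letterS w k : ruler_letter w k.+1 != ruler_letter w k.
Proof.
case: k => [|k] //; apply/eqP => -[_] /=.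
by case: (odd k).
Qed.

Definition crosses (s : gen) (l : label) : bool :=
  match s, l with
  | None, None => true
  | Some i, Some (j, _) => i != j
  | _, _ => false
  end.

Definition gen_fun (w : Omega) (s : gen) : seq bool -> seq bool :=
  if s is Some i then grig_fun i w else grig_a_fun.

(** * The Schreier graph of a level of the tree is a path *)

(** The position of a word on that path, which is also the position of the word
    followed by infinitely many 1s on the half-line. The pair 0u, 1u occupies
    the positions [2q] and [2q + 1], with [q] that of [u]; its orientation
    alternates so that 0u is at the end that faces the pair of the image of [u]
    under [a]. *)
Fixpoint gray (v : seq bool) : nat :=
  if v is x :: u then (gray u).*2 + (x == odd (gray u)) else 0.

Lemma gray_lt v : gray v < 2 ^ size v.
Proof. by elim: v => //= x u; rewrite expnS; case: (x == _); lia. Qed.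

Lemma gray_inj v1 v2 : size v1 = size v2 -> gray v1 = gray v2 -> v1 = v2.
Proof.
elim: v1 v2 => [|x u IH] [|y v] //= [/IH {}IH] E.
have guv : gray u = gray v by move: E; case: (x == _); case: (y == _); lia.
rewrite (IH guv); congr (_ :: _); move: E; rewrite guv => /addnI /eqP.
by case: x; case: y; case: (odd _).
Qed.

Lemma gray_surj n p : p < 2 ^ n -> exists2 v, size v = n & gray v = p.
Proof.
elim: n p => [|n IH] p; first by case: p => // _; exists [::].
rewrite expnS => ltp; have [|v sv gv] := IH p./2; first by lia.
exists ((odd p == odd p./2) :: v); first by rewrite /= sv.
rewrite /= gv; have := odd_double_half p.
by case: (odd p); case: (odd p./2) => /=; lia.
Qed.

Lemma gray_cat v r :
  2 ^ size v * gray r <= gray (v ++ r) < 2 ^ size v * (gray r).+1.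
Proof.
elim: v => [|x v IH] /=; first by lia.
by rewrite expnS; case: (x == _); lia.
Qed.

Lemma logn2_double m : 0 < m -> logn 2 m.*2 = (logn 2 m).+1.
Proof. by move=> m0; rewrite -mul2n lognM. Qed.

Lemma logn2_odd m : odd m -> logn 2 m = 0.
Proof. by move=> om; rewrite lognE dvdn2 om andbF. Qed.

Lemma logn2_even m : 0 < m -> ~~ odd m -> 0 < logn 2 m.
Proof. by move=> m0 em; rewrite logn_gt0 mem_primes m0 dvdn2 em. Qed.

Lemma gray_a v : 0 < size v ->
  gray (grig_a_fun v) = if odd (gray v) then (gray v).-1 else (gray v).+1.
Proof.
case: v => [//|x v] _ /=; rewrite oddD odd_double /=.
by case: x; case: (odd (gray v)) => /=; lia.
Qed.

Definition bcd_edge (i : 'I_3) (w : Omega) (m : nat) : bool :=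
  crosses (Some i) (ruler_letter w (logn 2 m)).

Lemma bcd_edge_odd i w m : odd m -> bcd_edge i w m = false.
Proof. by move=> om; rewrite /bcd_edge logn2_odd. Qed.

Lemma bcd_edge0 i w : bcd_edge i w 0 = false.
Proof. by rewrite /bcd_edge logn0. Qed.

Lemma bcd_edge_double_odd i w m : odd m -> bcd_edge i w m.*2 = (i != w 0).
Proof.
by move=> om; rewrite /bcd_edge logn2_double ?logn2_odd //; case: m om.
Qed.

Lemma bcd_edge_double_even i w m :
  ~~ odd m -> bcd_edge i w m.*2 = bcd_edge i (Omega_shift w) m.
Proof.
case: m => [|m] om; first by rewrite !bcd_edge0.
move: (logn2_even (ltn0Sn m) om).
by rewrite /bcd_edge logn2_double //; case: (logn 2 m.+1).
Qed.

Arguments bcd_edge : simpl never.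

(** The path of a level ends at [2 ^ size v - 1], whence the bound. At the
    origin no bound is needed, since [bcd_edge] is false at edge 0. *)
Lemma gray_bcd i w v :
  gray (grig_fun i w v) =
  if bcd_edge i w (gray v).+1 && ((gray v).+1 < 2 ^ size v) then (gray v).+1
  else if bcd_edge i w (gray v) then (gray v).-1 else gray v.
Proof.
elim: v w => [//|[] u IH] w /=.
  (* The word 1u: position q of u is doubled to the end of the pair that is
     away from the a-edge of u, so edge m of u becomes edge 2m. *)
  rewrite IH; set q := gray u; rewrite expnS.
  have odd2S : odd q.*2.+1 by rewrite oddS odd_double.
  have [oq|eq] := boolP (odd q) => /=.
    rewrite addn1 (bcd_edge_odd i w odd2S) -doubleS.
    rewrite (@bcd_edge_double_even i w q.+1) ?oddS ?oq //.
    rewrite (bcd_edge_odd i (Omega_shift w) oq).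
    have -> : (q.+1.*2 < 2 * 2 ^ size u) = (q.+1 < 2 ^ size u) by lia.
    by case: ifP; rewrite ?oddS oq /=; lia.
  rewrite addn0 (@bcd_edge_odd i _ q.+1) ?oddS ?eq //.
  rewrite (bcd_edge_odd i w odd2S) (bcd_edge_double_even i w eq) //=.
  case: ifP => [cq|_]; last by rewrite (negbTE eq); lia.
  have q0 : 0 < q by case: (q) cq; rewrite ?bcd_edge0.
  have -> : odd q.-1 by lia.
  by rewrite /=; lia.
case: u IH => [|x u] /= _; first by rewrite andbF.
(* The word 0xu: flipping x follows the a-edge of xu, whose odd number m turns
   into 2m; that edge has valuation one and the first letter of w as label. *)
have := gray_lt u; set q := gray u; set N := 2 ^ size u => ltq.
rewrite expnS -/N /eps.
set q1 := q.*2 + (x == odd q).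
have q1lt : q1 < 2 * N by rewrite /q1; case: (_ == _); lia.
have oq1 : odd q1 = (x == odd q).
  by rewrite /q1 oddD odd_double; case: (_ == _).
have odd2S : odd q1.*2.+1 by rewrite oddS odd_double.
rewrite -/q1; have [oq|eq] := boolP (odd q1) => /=.
  rewrite addn0 (bcd_edge_odd i w odd2S) /= (bcd_edge_double_odd i w oq).
  have xq : x = odd q by apply/eqP; rewrite -oq1.
  case: (i == w 0) => /=; first by rewrite -/q -/q1 oq; lia.
  have -> : (~~ x == odd q) = false by rewrite xq; case: (odd q).
  by rewrite addn0 odd_double; move: oq1; rewrite /q1 xq eqxx; lia.
rewrite expnS -/N addn1 -doubleS (@bcd_edge_double_odd i w q1.+1) //=.
rewrite (bcd_edge_odd i w odd2S).
have xq : (x == odd q) = false by rewrite -oq1 (negbTE eq).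
case: (i == w 0) => /=; first by rewrite -/q -/q1 (negbTE eq); lia.
have -> : (~~ x == odd q) = true by move: xq; case: (x); case: (odd q).
rewrite addn1 oddS odd_double /=.
have -> : q1 = q.*2 by rewrite /q1 xq addn0.
by have -> : q.*2.+1.*2 < 2 * (2 * N); lia.
Qed.

(** * Walks on lines with labelled edges *)

(** The label of edge 0 is a dummy: it is used at no vertex that is far from
    the origin. *)
Definition ruler (w : Omega) (m : int) : label :=
  ruler_letter w (logn 2 `|m|%N).

(** Edge [m] joins the vertices [m - 1] and [m]. *)
Definition step (x : int -> label) (s : gen) (p : int) : int :=
  if crosses s (x (p + 1)%R) then (p + 1)%R
  else if crosses s (x p) then (p - 1)%R else p.

Definition walk (x : int -> label) (u : seq gen) (p : int) : int :=
  foldr (step x) p u.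

Lemma step_dist x s p : `|(step x s p - p)%R|%N <= 1.
Proof. by rewrite /step; case: ifP => _; [|case: ifP => _]; lia. Qed.

Lemma walk_dist x u p : `|(walk x u p - p)%R|%N <= size u.
Proof.
elim: u => [|s u IH] /=; first by lia.
by have := step_dist x s (walk x u p); lia.
Qed.

Lemma walk_translate x y u (p q : int) :
  (forall i : int, `|i|%N <= size u -> x (p + i)%R = y (q + i)%R) ->
  (walk x u p - p = walk y u q - q)%R.
Proof.
elim: u => [|s u IH] /= xy; first by lia.
have {}IH : (walk x u p - p = walk y u q - q)%R.
  by apply: IH => i iu; apply: xy; lia.
have := walk_dist x u p.
set a := walk x u p in IH *; set b := walk y u q in IH *.
move=> ap; have E1 : x (a + 1)%R = y (b + 1)%R.
  have -> : (a + 1 = p + (a + 1 - p))%R by lia.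
  by rewrite xy; [congr (y _); lia | lia].
have E0 : x a = y b.
  have -> : (a = p + (a - p))%R by lia.
  by rewrite xy; [congr (y _); lia | lia].
by rewrite /step E1 E0; case: ifP => _; [|case: ifP => _]; lia.
Qed.

(** * Words trivial on the tree and far out on the half-line *)

Lemma gray_step w s v : 0 < gray v -> (gray v).+1 < 2 ^ size v ->
  Posz (gray (gen_fun w s v)) = step (ruler w) s (gray v).
Proof.
move=> v0 v1; rewrite /step /ruler.
have -> : `|(Posz (gray v) + 1)%R|%N = (gray v).+1 by lia.
rewrite absz_nat; case: s => [i|] /=.
  rewrite gray_bcd v1 andbT /bcd_edge /=.
  by case: ifP => _; [|case: ifP => _]; lia.
have sv : 0 < size v by case: (v) v0.
rewrite gray_a //.
have isN m : 0 < m ->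
    (if ruler_letter w (logn 2 m) is Some _ then false else true) = odd m.
  move=> m0; have [om|em] := boolP (odd m); first by rewrite logn2_odd.
  by move: (logn2_even m0 em); case: (logn 2 m).
by rewrite !isN // oddS; case: (odd _) => /=; lia.
Qed.

Definition tree_word (w : Omega) (u : seq gen) (v : seq bool) : seq bool :=
  foldr (gen_fun w) v u.

Lemma size_grig_fun i w v : size (grig_fun i w v) = size v.
Proof.
elim: v w => //= -[] u IH w /=; first by rewrite IH.
by case: u {IH}.
Qed.

Lemma size_gen_fun w s v : size (gen_fun w s v) = size v.
Proof. by case: s => [i|] /=; [exact: size_grig_fun|case: v]. Qed.

Lemma size_tree_word w u v : size (tree_word w u v) = size v.
Proof. by elim: u => //= s u IH; rewrite size_gen_fun. Qed.

Lemma take_grig_fun i w n v : take n (grig_fun i w v) = grig_fun i w (take n v).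
Proof.
elim: v w n => [|[] u IH] w n //=; first by case: n => //= n; rewrite IH.
by case: u {IH} n => [|x u] [|[|n]].
Qed.

Lemma take_gen_fun w s n v : take n (gen_fun w s v) = gen_fun w s (take n v).
Proof.
by case: s => [i|] /=; [exact: take_grig_fun|case: v n => [|x v] []].
Qed.

Lemma take_tree_word w u n v :
  take n (tree_word w u v) = tree_word w u (take n v).
Proof. by elim: u => //= s u IH; rewrite take_gen_fun IH. Qed.

Lemma gray_walk w u v : size u <= gray v -> gray v + size u < 2 ^ size v ->
  Posz (gray (tree_word w u v)) = walk (ruler w) u (gray v).
Proof.
elim: u => [|s u IH] //= ul ur.
have {}IH : Posz (gray (tree_word w u v)) = walk (ruler w) u (gray v).
  by apply: IH; lia.
rewrite -IH; have := walk_dist (ruler w) u (gray v); rewrite -IH => d.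
by apply: gray_step; rewrite ?size_tree_word; lia.
Qed.

Lemma ltn_2expn n : n < 2 ^ n. Proof. exact: ltn_expl. Qed.

(** A vertex [v] that is moved can be prolonged to a deep vertex whose position
    is far from both ends of the path, so that the walk on the half-line
    describes its image; that image differs from the vertex since it does so
    on [v]. *)
Lemma tree_word_trivialP w u :
  (forall v, tree_word w u v = v) <->
  (forall p : nat, size u < p -> walk (ruler w) u p = p).
Proof.
split=> [triv p up|triv v].
  have [|v sv gv] := @gray_surj (p + size u) p.
    by have := ltn_2expn (p + size u); lia.
  rewrite -gv -gray_walk ?triv // gv ?(ltnW up) // sv; exact: ltn_2expn.
(* The suffix [r] brings [v ++ r] to a position of at least [size u].+1, and
   its length leaves as much room towards the far end of the path. *)
have [|r sr gr] := @gray_surj (size u).+2 (size u).+1.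
  by have := ltn_2expn (size u); rewrite !expnS; lia.
have := gray_cat v r; rewrite gr.
have := ltn_2expn (size u); have := expn_gt0 2 (size v).
set N := 2 ^ size v => N0 uN /andP[gl gu].
have /eqP : Posz (gray (tree_word w u (v ++ r))) = Posz (gray (v ++ r)).
  rewrite gray_walk ?triv //; first by nia.
    by nia.
  by rewrite size_cat sr expnD !expnS -/N; nia.
rewrite eqz_nat => /eqP /gray_inj; rewrite size_tree_word => /(_ erefl) E.
rewrite -{1}(take_size_cat r (erefl (size v))) -take_tree_word E.
exact: take_size_cat.
Qed.

(** * The set of sequences that look locally like the half-line *)

(** The edges of the half-line are labelled periodically, except for those whose
    number is divisible by a large power of 2. *)
Lemma logn2_translate N (k e : int) : e != 0%R -> `|e|%N < 2 ^ N ->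
  logn 2 `|(k * Posz (2 ^ N) + e)%R|%N = logn 2 `|e|%N.
Proof.
move=> e0 eN; have e0' : 0 < `|e|%N by rewrite absz_gt0.
have [//|o o2 E] := pfactor_coprime (p := 2) _ e0'.
set a := logn 2 `|e|%N in E *.
have aN : a < N.
  rewrite -(ltn_exp2l a N (m := 2)) //; apply: leq_ltn_trans eN.
  by rewrite E leq_pmull // lt0n; apply: contraTneq e0' => o0; rewrite E o0.
have oo : odd o by rewrite coprime2n in o2.
have [b Nb] : exists b, N = a + b.+1 by exists (N - a).-1; lia.
have [o' [oo' Ee]] : exists o' : int, odd `|o'|%N /\ e = (o' * Posz (2 ^ a))%R.
  case: (lerP 0%R e) => es.
    by exists o; split; rewrite ?absz_nat //; lia.
  by exists (- Posz o)%R; split; rewrite ?abszN ?absz_nat //; lia.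
have -> : (k * Posz (2 ^ N) + e = (k * 2 * Posz (2 ^ b) + o') * Posz (2 ^ a))%R.
  by rewrite Ee Nb expnD expnS !PoszM; nia.
rewrite abszM absz_nat lognM ?expn_gt0 //; last by lia.
rewrite pfactorK // logn2_odd //.
set B := 2 ^ b.
have -> : (k * 2 * Posz B = 2 * (k * Posz B))%R by nia.
lia.
Qed.

(** The condition [n < p] keeps the window away from the dummy label of
    edge 0. *)
Definition schreier_set (w : Omega) : set (full_shift label) :=
  [set x | forall n : nat, exists p : nat, n < p /\
     forall i : int, `|i|%N <= n -> x i = ruler w (Posz p + i)%R].

(** A window of the half-line recurs with period [2 ^ N] for some [N], so that
    it occurs in every window of length about [2 * 2 ^ N], hence in every
    sequence of the set. *)
Lemma schreier_recurrence w x n p : schreier_set w x -> n < p ->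
  exists k : int, (0 < k)%R /\
    forall i : int, `|i|%N <= n -> x (k + i)%R = ruler w (Posz p + i)%R.
Proof.
move=> Xx np; pose N := p + n; have pN : p + n < 2 ^ N := ltn_2expn _.
have [q [qS xq]] := Xx (2 * 2 ^ N + n).
pose K := (q %/ 2 ^ N).+1.
have D0 : 0 < 2 ^ N by rewrite expn_gt0.
have Kq : q < K * 2 ^ N := ltn_ceil _ D0.
have KD : K * 2 ^ N <= q + 2 ^ N.
  by rewrite /K mulSn addnC leq_add2r leq_trunc_div.
exists (Posz p + Posz K * Posz (2 ^ N) - Posz q)%R; split; first by lia.
move=> i iN; rewrite xq; last by lia.
rewrite /ruler; congr (ruler_letter w _).
rewrite -(@logn2_translate N (Posz K) (Posz p + i)%R);
  [congr (logn 2 _)| |]; lia.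
Qed.

Lemma schreier_set_shift w x (c : int) :
  schreier_set w x -> schreier_set w (fun i => x (i + c)%R).
Proof.
move=> Xx n; have [p [np xp]] := Xx (n + `|c|%N).
have [q pc] : exists q : nat, (Posz p + c)%R = Posz q.
  by exists `|(Posz p + c)%R|%N; lia.
exists q; split; first by lia.
by move=> i iN; rewrite xp -?pc; [congr (ruler w _)|]; lia.
Qed.

Lemma schreier_windows_recur w x y n : schreier_set w x -> schreier_set w y ->
  exists k : int, (0 < k)%R /\
    forall i : int, `|i|%N <= n -> y i = x (k + i)%R.
Proof.
move=> Xx Yy; have [p [np yp]] := Yy n.
have [k [k0 xk]] := schreier_recurrence Xx np.
by exists k; split=> // i iN; rewrite yp // xk.
Qed.

(** If [a] is the valuation of the period [k], translation by [k] sends an edge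
    of valuation [a + 1] to one of valuation [a], which has another label. *)
Lemma schreier_aperiodic w x (k : int) :
  schreier_set w x -> (forall i : int, x (i + k)%R = x i) -> k = 0%R.
Proof.
wlog k0 : k / is_true (0 <= k)%R => [wl|].
  case: (lerP 0%R k) => [/wl//|kN] Xx xk.
  have : (- k = 0)%R by apply: wl => // [|i]; [lia | rewrite -[LHS]xk subrK].
  by lia.
case: k k0 => [k|//] _ Xx xk; apply/eqP; rewrite eqz_nat -leqn0 leqNgt.
apply/negP => k0.
have [//|o o2 E] := pfactor_coprime (p := 2) _ k0.
have oo : odd o by rewrite coprime2n in o2.
set a := logn 2 k in E.
(* An edge of valuation a + 1; as [k < p], the window of radius [k] around it,
   which contains edge [p + k], lies on the half-line. *)
pose p := (2 * k).+1 * 2 ^ a.+1.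
have ap : 0 < 2 ^ a by rewrite expn_gt0.
have kp : k < p by rewrite /p expnS; nia.
have [c [_ xc]] := schreier_recurrence Xx kp.
have Ep : logn 2 p = a.+1.
  by rewrite /p lognM ?expn_gt0 // pfactorK // logn2_odd //; lia.
have Epk : logn 2 (p + k) = a.
  have -> : p + k = ((2 * k).+1 * 2 + o) * 2 ^ a.
    by rewrite mulnDl -E /p expnS; lia.
  by rewrite lognM ?expn_gt0 // ?pfactorK // ?logn2_odd //; lia.
have := ruler_letterS w a; rewrite -[in X in X != _]Ep -[in X in _ != X]Epk.
apply/negP; rewrite negbK; apply/eqP.
have : ruler w (Posz p + Posz k)%R = ruler w (Posz p + 0)%R.
  by rewrite -xc ?absz_nat // xk -xc // addr0.
by rewrite addr0 /ruler -PoszD !absz_nat.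
Qed.

(** One of two adjacent edges has an odd number and is crossed by [a] only, and
    the other is not crossed by [a]. *)
Lemma schreier_not_both_crossed w x s i : schreier_set w x ->
  crosses s (x i) -> ~~ crosses s (x (i + 1)%R).
Proof.
move=> Xx; have [p [np xp]] := Xx `|i|.+1.
rewrite xp ?xp; try lia.
have [q [q0 Eq]] : exists q : nat, 0 < q /\ (Posz p + i)%R = q.
  by exists `|(Posz p + i)%R|%N; lia.
rewrite addrA Eq /ruler absz_nat.
have -> : `|(Posz q + 1)%R|%N = q.+1 by lia.
have letter_even m : 0 < m -> ~~ odd m -> logn 2 m = (logn 2 m).-1.+1.
  by move=> m0 em; rewrite prednK // logn2_even.
have [oq|eq] := boolP (odd q).
  rewrite (logn2_odd oq) [logn 2 q.+1]letter_even ?oddS ?oq //.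
  by case: s.
rewrite [logn 2 q.+1]logn2_odd ?oddS // letter_even //.
by case: s.
Qed.

(** The half-line seen from the 2-adic number -1/3: the valuation of
    [i - 1/3] is that of [3 i - 1], which vanishes for no integer [i], so that
    no dummy label is needed. *)
Definition toeplitz (w : Omega) : full_shift label :=
  fun i => ruler_letter w (logn 2 `|(3 * i - 1)%R|%N).

Lemma toeplitz_schreier w : schreier_set w (toeplitz w).
Proof.
(* The integers [p] = (4 ^ N - 1) / 3 approximate -1/3. *)
move=> n; pose N := (3 * n).+2.
have [p Ep] : exists p, 4 ^ N = 3 * p + 1.
  elim: N => [|N [p E]]; first by exists 0.
  by exists (4 * p + 1); rewrite expnS E; lia.
have E4 : 4 ^ N = 2 ^ (2 * N) by rewrite expnM.
have := ltn_2expn (2 * N); rewrite -E4 Ep => pN.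
exists p; split; first by lia.
move=> i iN; rewrite /toeplitz /ruler; congr (ruler_letter w _).
have -> : logn 2 `|(Posz p + i)%R| = logn 2 (3 * `|(Posz p + i)%R|).
  by rewrite lognM //; lia.
rewrite -(@logn2_translate (2 * N) 1 (3 * i - 1)%R) -?E4 ?Ep;
  [congr (logn 2 _)| |]; lia.
Qed.

Lemma ruler_window w p n : n < p -> exists2 x, schreier_set w x &
  forall i : int, `|i|%N <= n -> x i = ruler w (Posz p + i)%R.
Proof.
move=> np; have [k [_ xk]] := schreier_recurrence (toeplitz_schreier w) np.
exists (fun i => toeplitz w (i + k)%R).
  exact/schreier_set_shift/toeplitz_schreier.
by move=> i iN; rewrite addrC xk.
Qed.
(** * Subshifts homeomorphic to the Cantor set *)

Lemma closed_map_continuous (S T : topologicalType) (f : S -> T) (g : T -> S) :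
  cancel f g -> cancel g f -> (forall A, closed A -> closed (f @` A)) ->
  continuous g.
Proof.
move=> fK gK cf; apply/continuous_closedP => A /cf.
suff -> : g @^-1` A = f @` A by [].
rewrite eqEsubset; split=> [y Ay|_ [x Ax <-]] /=; last by rewrite fK.
by exists (g y).
Qed.

Lemma cantor_like_homeomorphic (R : realType) (T : pseudoPMetricType R) :
  cantor_like T -> homeomorphic T cantor_space.
Proof.
move=> /homeomorphism_cantor_like[f [cf clf]].
have fK : cancel f f^-1%FUN by move=> x; rewrite funK ?inE.
have gK : cancel f^-1%FUN f by move=> x; rewrite invK ?inE.
exists (f^-1)%FUN, f; split => //.
exact: closed_map_continuous clf.
Qed.

(** The ambient space [F] and its pseudometric version [P] are identified by an
    equation, so that for a product only the two product topologies have to be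
    compared by conversion, and not those of its subspace [A]. *)
Lemma subset_homeomorphic_cantor (R : realType) (P : pseudoMetricType R)
    (F : topologicalType) (A : set F) (x : A) :
  F = P :> topologicalType -> cantor_like A -> homeomorphic A cantor_space.
Proof.
move=> FP; subst F; move=> CA.
pose T : pseudoPMetricType R := HB.pack (A : Type)
  (PseudoMetric.class (A : pseudoMetricType R)) (isPointed.Build A x).
exact: (@cantor_like_homeomorphic _ T).
Qed.

Lemma subshift_homeomorphic_cantor (A : finType) (X : subshift A) (x : X) :
  cantor_like X -> homeomorphic X cantor_space.
Proof.
exact: (@subset_homeomorphic_cantor Rdefinitions.R
  {ptws int -> discrete_topology A} _ _ x erefl).
Qed.

Definition agree (K : Type) (n : nat) (x y : int -> K) : Prop :=
  forall i : int, `|i|%N <= n -> y i = x i.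

Lemma nbhs_agree (A : finType) (x : full_shift A) n : nbhs x (agree n x).
Proof.
have coord (i : int) : nbhs x [set y | y i = x i].
  exact: (@proj_continuous int (fun=> discrete_topology A) i x _
            (discrete_set1 (x i))).
elim: n => [|n IH].
  apply: filterS (coord 0%R) => y y0 i i0.
  by have -> : i = 0%R by lia.
have FF : Filter (nbhs x) := nbhs_filter x.
have := @filterI _ _ FF _ _ (coord (Posz n.+1)) (coord (- Posz n.+1)%R).
move=> /(@filterI _ _ FF _ _ IH).
apply: filterS => y [yn [yp ym]] i.
rewrite leq_eqVlt => /orP[/eqP iN|]; last exact: yn.
by have [->|->] : i = Posz n.+1 \/ i = (- Posz n.+1)%R by lia.
Qed.

(** A filter converges as soon as all its coordinates do, so the filter
    generated by the windows of [x] converges to [x], i.e. contains all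
    neighbourhoods. *)
Lemma nbhs_agreeP (A : finType) (x : full_shift A) (U : set (full_shift A)) :
  nbhs x U <-> exists n, agree n x `<=` U.
Proof.
split=> [|[n nU]]; last exact: filterS nU (nbhs_agree x n).
pose F := filter_from [set: nat] (fun n => agree n x).
have FF : Filter F.
  apply: filter_from_filter; first by exists 0%N.
  move=> m n _ _; exists (maxn m n) => // y ya; split=> i ia; apply: ya; lia.
suff Fx : F --> x by move=> /Fx [n _ nU]; exists n.
apply/cvg_sup => i U'.
have /= -> := @nbhsE (initial_topology
  (fun f : {ptws int -> discrete_topology A} => f i)).
move=> [_ [[C oC <-] /= Cx]] CU; exists `|i|%N => // y ya.
by apply: CU; rewrite /= ya.
Qed.

Section SubshiftTopology.
Variables (A : finType) (X : subshift A).

Lemma nbhs_subshiftP (x : X) (U : set X) :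
  nbhs x U <-> exists n, forall y : X, agree n (val x) (val y) -> U y.
Proof.
split=> [[W [[V oV <-] /= Vx] VU]|[n nU]].
  have /nbhs_agreeP[n nV] : nbhs (val x) V by apply: open_nbhs_nbhs; split.
  by exists n => y /nV Vy; apply: VU.
have : \forall y \near x, agree n (val x) (val y).
  exact: (@initial_continuous X (full_shift A) set_val x _
            (nbhs_agree (val x) n)).
by apply: filterS => y /nU.
Qed.

Lemma subshift_zero_dimensional : zero_dimensional X.
Proof.
move=> x y xy; have [i xyi] : exists i, val x i <> val y i.
  apply/existsNP => E; move/eqP: xy; apply; apply: val_inj; exact/funext.
have open_coord (P : A -> Prop) : open [set z : X | P (val z i)].
  rewrite openE => z Pz; apply/nbhs_subshiftP; exists `|i|%N => t tz.
  by rewrite /= tz.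
exists [set z : X | val z i = val x i]; split=> //; last by move=> /esym.
split; first exact: (open_coord (fun a => a = val x i)).
by rewrite -openC; exact: (open_coord (fun a => a <> val x i)).
Qed.

Lemma zero_dimensional_hausdorff (T : topologicalType) :
  zero_dimensional T -> hausdorff_space T.
Proof.
move=> zd p q pq; apply: contrapT => /eqP /zd[U [[oU cU] Up Uq]].
have nU : nbhs p U by exact: open_nbhs_nbhs.
have nUC : nbhs q (~` U).
  by apply: open_nbhs_nbhs; split=> //; exact: closed_openC.
by have [z [Uz /(_ Uz)]] := pq _ _ nU nUC.
Qed.

Lemma full_shift_compact : compact [set: full_shift A].
Proof.
have fA : compact [set: discrete_topology A].
  exact/finite_compact/finite_finset.
have := @tychonoff int (fun=> discrete_topology A) _ (fun=> fA).
by congr (compact _); rewrite eqEsubset.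
Qed.

Lemma subshift_compact : compact [set: X].
Proof.
move=> F PF _.
have cX : compact (subshift_set X).
  apply: subclosed_compact full_shift_compact _ => //.
  exact: subshift_closed.
pose G := (set_val : X -> full_shift A) @ F.
have [|v [Xv Gv]] := cX G _.
  by apply: (@filterE _ F) => x; exact: set_valP.
exists (exist _ v (mem_set Xv)); split=> // B U FB /nbhs_subshiftP[n nU].
have GB : G (set_val @` B) by apply: (@filterS _ F) FB => x Bx; exists x.
have [_ [[x Bx <-] xv]] := Gv _ _ GB (nbhs_agree v n).
by exists x; split=> //; apply: nU.
Qed.

Lemma subshift_cantor_like :
  (forall (x : X) n, exists2 y : X, y <> x & agree n (val x) (val y)) ->
  cantor_like X.
Proof.
move=> noniso; split.
- apply/perfectTP => x ox.
  have /nbhs_subshiftP[n nx] : nbhs x [set x] by apply: open_nbhs_nbhs; split.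
  by have [y yx /nx] := noniso x n.
- exact: subshift_compact.
- exact/zero_dimensional_hausdorff/subshift_zero_dimensional.
- exact: subshift_zero_dimensional.
Qed.

Lemma val_homeo_pow (k : int) (x : X) (i : int) :
  val (homeo_pow (subshift_map X) k x) i = val x (i + k)%R.
Proof.
have S y j : val (subshift_map X y) j = val y (j + 1)%R by [].
have pos n j :
    val (homeo_pow (subshift_map X) (Posz n) x) j = val x (j + Posz n)%R.
  elim: n j => [|n IH] j; first by rewrite addr0.
  by rewrite -addn1 PoszD homeo_pow1D S IH; congr (val x _); lia.
case: k => [n|n]; first exact: pos.
have neg m j :
    val (homeo_pow (subshift_map X) (- Posz m)%R x) j = val x (j - Posz m)%R.
  elim: m j => [|m IH] j; first by rewrite oppr0 addr0.
  have := IH (j - 1)%R.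
  have -> : (- Posz m = - Posz m.+1 + 1)%R by lia.
  rewrite homeo_pow1D S subrK => ->; congr (val x _); lia.
by rewrite NegzE neg.
Qed.

Lemma subshift_orbits_dense :
  (forall (x y : X) n, exists k : int, forall i : int, `|i|%N <= n ->
     val y i = val x (i + k)%R) ->
  forall x : X, dense (Defs.orbit (subshift_map X) x).
Proof.
move=> rec x O [y Oy] oO.
have /nbhs_subshiftP[n nO] : nbhs y O by apply: open_nbhs_nbhs; split.
have [k xy] := rec x y n.
exists (homeo_pow (subshift_map X) k x); split; last by exists k.
by apply: nO => i iN; rewrite val_homeo_pow xy.
Qed.

End SubshiftTopology.
(** * Words in involutive generators *)

Section Words.
Variables (I : Type) (G : groupType) (a : I -> G).

Definition word (u : seq I) : G := foldr (fun i g => a i * g)%g 1%g u.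

Lemma word_cat u v : word (u ++ v) = (word u * word v)%g.
Proof. by elim: u => [|i u IH] /=; rewrite ?mul1g // IH mulgA. Qed.

Lemma word_rev u : (forall i, a i * a i = 1)%g -> word (rev u) = (word u)^-1%g.
Proof.
move=> aa; elim: u => [|i u IH]; first by rewrite /= invg1.
rewrite rev_cons -cats1 word_cat IH /= mulg1 invgM; congr (_ * _)%g.
by apply: (mulgI (a i)); rewrite mulgV aa.
Qed.

End Words.

(** As the generators are involutions, equality of two words amounts to
    triviality of a third one, so that sending a word in [a] to the same word in
    [b] is well defined and injective. *)
Lemma embedding_of_words (I : Type) (G K : groupType)
    (a : I -> G) (b : I -> K) :
  (forall i, a i * a i = 1)%g -> (forall i, b i * b i = 1)%g ->
  (forall g, exists u, g = word a u) ->
  (forall u, word a u = 1%g <-> word b u = 1%g) ->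
  exists f : {multiplicative G -> K}, injective f.
Proof.
move=> aa bb gen_a ab.
have same u v : word a u = word a v <-> word b u = word b v.
  have quot (L : groupType) (c : I -> L) : (forall i, c i * c i = 1)%g ->
      word c u = word c v <-> word c (u ++ rev v) = 1%g.
    move=> cc; rewrite word_cat word_rev //.
    split=> [->|E]; first by rewrite mulgV.
    by apply: (mulIg (word c v)^-1%g); rewrite E mulgV.
  by rewrite (quot _ a) // (quot _ b).
pose f (g : G) : K := word b (projT1 (cid (gen_a g))).
have fE u : f (word a u) = word b u.
  by rewrite /f; case: cid => v /= /same.
have fM : {morph f : x y / (x * y)%g}.
  move=> x y; have [u ->] := gen_a x; have [v ->] := gen_a y.
  by rewrite -word_cat !fE word_cat.
exists (HB.pack f (isMultiplicative.Build G K f fM) : {multiplicative G -> K}).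
move=> x y; have [u ->] := gen_a x; have [v ->] := gen_a y.
by rewrite /= !fE => /same.
Qed.

(** * The minimal subshift *)

Lemma schreier_closed w : closed (schreier_set w).
Proof.
move=> x clx n; have [y [Yy xy]] := clx _ (nbhs_agree x n).
by have [p [np yp]] := Yy n; exists p; split=> // i iN; rewrite -xy // yp.
Qed.

Lemma schreier_invariant w : @shift label @` (schreier_set w) = schreier_set w.
Proof.
rewrite eqEsubset; split=> [_ [x Xx <-]|x Xx]; first exact: schreier_set_shift.
exists (@unshift label x); last exact: unshiftK.
exact: (@schreier_set_shift w x (- 1)%R).
Qed.

Definition schreier_subshift w : subshift label :=
  Subshift (@schreier_closed w) (@schreier_invariant w).

Definition schreier_point w x (Xx : schreier_set w x) : schreier_subshift w :=
  @exist _ (fun y => y \in subshift_set (schreier_subshift w)) x (mem_set Xx).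

Lemma schreier_minimal_subshift w : minimal_subshift (schreier_subshift w).
Proof.
split; last first.
  apply: subshift_orbits_dense => x y n.
  have [k [_ xy]] := schreier_windows_recur n (set_valP x) (set_valP y).
  by exists k => i /xy; rewrite addrC.
apply: (subshift_homeomorphic_cantor (schreier_point (toeplitz_schreier w))).
apply: subshift_cantor_like => x n.
have [k [k0 xy]] := schreier_windows_recur n (set_valP x) (set_valP x).
exists (homeo_pow (subshift_map _) k x).
  move=> E; have H := @schreier_aperiodic w (val x) k (set_valP x).
  suff : k = 0%R by lia.
  by apply: H => i; rewrite -val_homeo_pow E.
by move=> i iN; rewrite val_homeo_pow addrC -xy.
Qed.

(** * The action of the generators on the subshift *)

Section Action.
Variable w : Omega.
Local Notation X := (schreier_subshift w).
Local Notation phi := (subshift_map X).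

Definition act (s : gen) (x : X) : X := homeo_pow phi (step (val x) s 0%R) x.

(** After crossing an edge, the same edge is crossed back: the next edge in the
    same direction is not crossed by [s]. *)
Lemma step_involutive x s p : schreier_set w x -> step x s (step x s p) = p.
Proof.
move=> Xx; rewrite {2}/step; case: ifP => [c1|c1].
  rewrite /step c1 addrK; have := schreier_not_both_crossed Xx c1.
  by move=> /negbTE ->.
case: ifP => [c0|c0]; last by rewrite /step c1 c0.
by rewrite /step subrK c0.
Qed.

Lemma step_translate (x y : int -> label) s (p : int) :
  (forall i, y i = x (i + p)%R) -> (step y s 0 = step x s p - p)%R.
Proof.
move=> yx; have := @walk_translate x y [:: s] p 0%R.
by move=> /= -> => [|i _]; [lia | rewrite add0r yx addrC].
Qed.

(** Acting on [x] translates the walk to the new origin, where its second step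
    is the one back. *)
Lemma actK s : involutive (act s).
Proof.
move=> x; have Xx : schreier_set w (val x) := set_valP x.
rewrite {1}/act (@step_translate (val x) _ s (step (val x) s 0%R)); last first.
  by move=> i; rewrite val_homeo_pow.
by rewrite step_involutive // -homeo_powD sub0r addNr.
Qed.

Lemma agree_step (x y : int -> label) s :
  agree 1 x y -> step y s 0%R = step x s 0%R.
Proof. by move=> xy; rewrite /step !xy. Qed.

Lemma act_continuous s : continuous (act s).
Proof.
move=> x U /nbhs_subshiftP[n nU]; apply/nbhs_subshiftP; exists n.+1 => y xy.
apply: nU => i iN; rewrite !val_homeo_pow.
rewrite (@agree_step (val x)); last by move=> j j1; apply: xy; lia.
apply: xy; have := step_dist (val x) s 0%R; lia.
Qed.

Lemma act_homeoP s : Sym (actK s) (actK s) \in @homeo_pred X.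
Proof. by apply/asboolP; split; exact: act_continuous. Qed.

Lemma act_full_groupP s : Homeo (act_homeoP s) \in full_group_pred phi.
Proof.
apply/asboolP; exists (fun x => step (val x) s 0%R) => //.
apply: (iffRL (continuous_discreteP _)) => x; apply/nbhs_subshiftP.
by exists 1 => y xy; exact: agree_step.
Qed.

Definition full_gen (s : gen) : topological_full_group phi :=
  TopologicalFullGroup (act_full_groupP s).

Lemma full_gen2 s : (full_gen s * full_gen s = 1)%g.
Proof. by apply/val_inj/val_inj/symP => x; exact: actK. Qed.

Lemma full_wordE u (x : X) :
  word full_gen u x = homeo_pow phi (walk (val x) u 0%R) x.
Proof.
elim: u => [//|s u IH].
have ME (g h : topological_full_group phi) y : (g * h)%g y = g (h y) by [].
rewrite [word _ _]/= ME IH -[LHS]/(act s _) /act.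
rewrite (@step_translate (val x) _ s (walk (val x) u 0%R)); last first.
  by move=> i; rewrite val_homeo_pow.
by rewrite -homeo_powD subrK.
Qed.

(** The displacement of a point under a word is the one of the walk on a window,
    and every window is one of the half-line. Conversely a point showing
    the window around [p] is fixed only if its displacement is zero. *)
Lemma full_word_trivialP u :
  word full_gen u = 1%g <->
  (forall p : nat, size u < p -> walk (ruler w) u p = p).
Proof.
split=> [E p up|triv].
  have [x Xx xp] := ruler_window w up.
  have := full_wordE u (schreier_point Xx); rewrite E /=.
  set k := walk x u 0%R => kx.
  have k0 : k = 0%R.
    apply: (schreier_aperiodic Xx) => i.
    by rewrite -[LHS](val_homeo_pow k (schreier_point Xx)) -kx.
  have := @walk_translate x (ruler w) u 0%R p.
  rewrite -/k k0 => H.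
  suff : (0 - 0 = walk (ruler w) u p - Posz p :> int)%R by lia.
  by apply: H => i iu; rewrite add0r xp.
apply/val_inj/val_inj/symP => x; rewrite sym1E.
rewrite [LHS]full_wordE.
have [p [np xp]] := set_valP x (size u).
have : (walk (val x) u 0 - 0 = walk (ruler w) u p - Posz p :> int)%R.
  by apply: walk_translate => i iu; rewrite add0r xp.
by rewrite triv // => E; have -> : walk (val x) u 0%R = 0%R by lia.
Qed.

(** * The embedding *)

Definition tree_gen (s : gen) : tree_aut :=
  if s is Some i then grig_bcd i w else grig_a.

Lemma tree_gen2 s : (tree_gen s * tree_gen s = 1)%g.
Proof.
apply/val_inj/symP => v.
by case: s => [i|]; [exact: grig_funK | exact: grig_a_funK].
Qed.

Lemma tree_wordE u v : word tree_gen u v = tree_word w u v.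
Proof.
elim: u => [//|s u IH].
have -> : word tree_gen (s :: u) v = gen_fun w s (word tree_gen u v) by case: s.
by rewrite IH.
Qed.

Local Notation gens := [set grig_a; grig_b w; grig_c w; grig_d w].

Lemma gens_tree_gen s : gens (tree_gen s).
Proof.
case: s => [i|]; last by left; left; left.
case: i => [[|[|[|//]]] lti].
- by right; congr (grig_bcd _ w); exact: val_inj.
- by left; right; congr (grig_bcd _ w); exact: val_inj.
- by left; left; right; congr (grig_bcd _ w); exact: val_inj.
Qed.

Lemma grig_genP s : tree_gen s \in gen_pred gens.
Proof. by apply/asboolP => H _; apply; exact: gens_tree_gen. Qed.

Definition grig_gen (s : gen) : grigorchuk_group w := Generated (grig_genP s).

Lemma grig_wordE u : \val (word grig_gen u) = word tree_gen u.
Proof. by elim: u => //= s u <-. Qed.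

Lemma grig_gen2 s : (grig_gen s * grig_gen s = 1)%g.
Proof. by apply: val_inj; exact: tree_gen2. Qed.

Lemma grig_word_surj (g : grigorchuk_group w) : exists u, g = word grig_gen u.
Proof.
suff [u gu] : exists u, \val g = word tree_gen u.
  by exists u; apply: val_inj; rewrite grig_wordE.
have /asboolP := generated_valP g.
move=> /(_ (fun g => `[< exists u, g = word tree_gen u >])) gP.
apply/asboolP; apply: gP.
  split=> [|_ _ /asboolP[u ->] /asboolP[v ->]]; apply/asboolP.
    by exists [::].
  by exists (u ++ rev v); rewrite word_cat word_rev //; exact: tree_gen2.
move=> s Ss; apply/asboolP; case: Ss => [[[->|->]|->]|->].
- by exists [:: None]; rewrite /= mulg1.
- by exists [:: Some (@Ordinal 3 2 isT)]; rewrite /= mulg1.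
- by exists [:: Some (@Ordinal 3 1 isT)]; rewrite /= mulg1.
- by exists [:: Some (@Ordinal 3 0 isT)]; rewrite /= mulg1.
Qed.

Lemma grig_word_trivialP u :
  word grig_gen u = 1%g <->
  (forall p : nat, size u < p -> walk (ruler w) u p = p).
Proof.
rewrite -tree_word_trivialP; split=> [E v|triv].
  by rewrite -tree_wordE -grig_wordE E.
apply: val_inj; rewrite grig_wordE; apply/val_inj/symP => v.
by rewrite tree_wordE triv.
Qed.

End Action.

Theorem theorem1p1 (w : Omega) :
  exists (A : finType) (X : subshift A),
    minimal_subshift X /\
    exists f : {multiplicative grigorchuk_group w ->
                topological_full_group (subshift_map X)},
      injective f.
Proof.
exists label, (schreier_subshift w).
split; first exact: schreier_minimal_subshift.
apply: (@embedding_of_words gen _ _ (@grig_gen w) (@full_gen w)).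
- exact: grig_gen2.
- exact: full_gen2.
- exact: grig_word_surj.
- by move=> u; rewrite grig_word_trivialP full_word_trivialP.
Qed.
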